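(* Let $\mathfrak F=\langle M,R\rangle$ be a fixed frame, i.e. $M$ is a non-empty set (finite or infinite) and $R\subseteq M^2$. For $\Gamma$ a finite set of (modal) MD-sentences and $\gamma$ a (modal) MD-sentence, $\Gamma\vdash_{\mathfrak F}\gamma$ if and only if $\Gamma\vDash_{\mathfrak F}\gamma$.
   Context: Fix a real-valued logic, i.e. a collection of connectives, each $n$-ary connective $\circ$ being interpreted by a function $\circ\colon[0,1]^n\to[0,1]$, and a vocabulary $\tau$ of propositional variables. Modal formulas are built from propositional variables with the connectives and the unary operators $\Box,\Diamond$. Models. A model $\mathfrak M$ based on $\mathfrak F$ interprets each $p\in\tau$ by a map $p_{\mathfrak M}\colon M\to[0,1]$. Truth-values at $w\in M$: $\|p[w]\|_{\mathfrak M}=p_{\mathfrak M}(w)$; $\|\circ(\varphi_1,\ldots,\varphi_n)[w]\|_{\mathfrak M}=\circ(\|\varphi_1[w]\|_{\mathfrak M},\ldots,\|\varphi_n[w]\|_{\mathfrak M})$; $\|\Box\varphi[w]\|_{\mathfrak M}=\inf\{\|\varphi[v]\|_{\mathfrak M}\mid v\in M,\langle w,v\rangle\in R\}$; $\|\Diamond\varphi[w]\|_{\mathfrak M}=\sup\{\|\varphi[v]\|_{\mathfrak M}\mid v\in M,\langle w,v\rangle\in R\}$ (inf and sup are taken in $[0,1]$, so $\inf\emptyset=1$, $\sup\emptyset=0$). The formula $\varphi$ is interpreted in (defines in) $\mathfrak M$ the map $M\to[0,1]$, $w\mapsto\|\varphi[w]\|_{\mathfrak M}$. MD-sentences. A (modal)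 MD-sentence is an expression $\langle\varphi_1,\ldots,\varphi_k;S\rangle$ with each $\varphi_i$ a modal formula and $S\subseteq([0,1]^M)^k$. $\mathfrak M\models\langle\varphi_1,\ldots,\varphi_k;S\rangle$ if the maps $f_1,\ldots,f_k$ defined by $\varphi_1,\ldots,\varphi_k$ in $\mathfrak M$ satisfy $\langle f_1,\ldots,f_k\rangle\in S$. $\Gamma\vDash_{\mathfrak F}\gamma$ means that every model based on $\mathfrak F$ satisfying all members of $\Gamma$ satisfies $\gamma$. Good tuples. Given $\langle\varphi_1,\ldots,\varphi_k;S\rangle$, a tuple $\langle f_1,\ldots,f_k\rangle\in S$ is good if: (a) $f_m=\circ(f_{m_1},\ldots,f_{m_j})$ (pointwise) whenever $\varphi_m=\circ(\varphi_{m_1},\ldots,\varphi_{m_j})$; (b) $f_i(w)=\inf\{f_j(e)\mid e\in M,\langle w,e\rangle\in R\}$ for all $w\in M$ whenever $\varphi_i=\Box\varphi_j$; (c) $f_i(w)=\sup\{f_j(e)\mid e\in M,\langle w,e\rangle\in R\}$ for all $w\in M$ whenever $\varphi_i=\Diamond\varphi_j$. Proof system. Axiom (1): $\langle\varphi_1,\ldots,\varphi_k;[0,1]^M\times\cdots\times[0,1]^M\rangle$ for all modal formulas $\varphi_1,\ldots,\varphi_k$. Rule (2): from $\langle\varphi_1,\ldots,\varphi_k;S\rangle$ infer $\langle\varphi_{\pi(1)},\ldots,\varphi_{\pi(k)};S'\rangle$, where $\pi$ is a permutation of $1,\ldots,k$ and $S'=\{\langle f_{\pi(1)},\ldots,f_{\pi(k)}\rangle\mid\langle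 f_1,\ldots,f_k\rangle\in S\}$. Rule (3): from $\langle\varphi_1,\ldots,\varphi_k;S\rangle$ infer $\langle\varphi_1,\ldots,\varphi_k,\varphi_{k+1},\ldots,\varphi_m;S\times[0,1]^M\times\cdots\times[0,1]^M\rangle$. Rule (4): from $\langle\varphi_1,\ldots,\varphi_k;S_1\rangle$ and $\langle\varphi_1,\ldots,\varphi_k;S_2\rangle$ infer $\langle\varphi_1,\ldots,\varphi_k;S_1\cap S_2\rangle$. Rule (5): for $0<r<k$, from $\langle\varphi_1,\ldots,\varphi_k;S\rangle$ infer $\langle\varphi_1,\ldots,\varphi_{k-r};S'\rangle$, where $S'=\{\langle f_1,\ldots,f_{k-r}\rangle\mid\langle f_1,\ldots,f_k\rangle\in S\}$. Rule (6): from $\langle\varphi_1,\ldots,\varphi_k;S\rangle$ infer $\langle\varphi_1,\ldots,\varphi_k;S'\rangle$ whenever $S\subseteq S'$. Rule (7): from $\langle\varphi_1,\ldots,\varphi_k;S\rangle$ infer $\langle\varphi_1,\ldots,\varphi_k;S'\rangle$, where $S'$ is the set of good tuples in $S$. $\Gamma\vdash_{\mathfrak F}\gamma$ means that there is a finite sequence of MD-sentences ending in $\gamma$, each element of which is an axiom, a member of $\Gamma$, or follows from previous elements by one of the rules.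
   Formalization: Completeness is proved if no MD-sentence involved lists a propositional variable twice, or if finitely many connectives separate truth values; without this it fails: no connectives, one point, R empty, valid but unprovable ⟨p,p;{(f,f)}⟩. MD-sentences have k≥1. *)

(* Defs.v *)
(* Modal MD-sentences over an arbitrary real-valued logic, in MathComp with
   MathComp-Analysis. *)
From HB Require Import structures.
From mathcomp Require Import all_boot all_order all_algebra all_fingroup.
From mathcomp Require Import all_classical all_reals interval_inference.

Set Implicit Arguments.
Unset Strict Implicit.
Unset Printing Implicit Defensive.

Import Order.TTheory GRing.Theory Num.Theory.

Local Open Scope classical_set_scope.
Local Open Scope ring_scope.

(* [infimum] and [supremum] return their first argument on the empty set and the
   bound in the ordered type {i01 R} otherwise, so these are the bounds in the
   complete lattice [0,1]. *)
Definition inf01 (R : realType) (A : set {i01 R}) : {i01 R} :=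
  infimum 1%:i01 A.
Definition sup01 (R : realType) (A : set {i01 R}) : {i01 R} :=
  supremum 0%:i01 A.

Record logic (R : realType) := Logic {
  connective : Type;
  arity : connective -> nat;
  interp : forall c : connective, ('I_(arity c) -> {i01 R}) -> {i01 R}
}.
Arguments interp {R l} c _.

Inductive formula (R : realType) (L : logic R) (tau : Type) :=
| Var of tau
| Conn (c : connective L) of 'I_(arity c) -> formula L tau
| Box of formula L tau
| Dia of formula L tau.
Arguments Var {R L tau} _.
Arguments Conn {R L tau} c _.

Record frame := Frame {
  world : Type;
  world_nonempty : inhabited world;
  acc : set (world * world)
}.

Section MDSentences.
Variables (R : realType) (L : logic R) (tau : Type) (F : frame).
Local Notation I := {i01 R}.
Local Notation W := (world F).
Local Notation fml := (formula L tau).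

Definition inf_acc (f : W -> I) (w : W) : I := inf01 (f @` [set v | acc (w, v)]).
Definition sup_acc (f : W -> I) (w : W) : I := sup01 (f @` [set v | acc (w, v)]).

(* A model based on F. *)
Definition model := tau -> W -> I.

Fixpoint truth (V : model) (phi : fml) : W -> I :=
  match phi with
  | Var p => V p
  | Conn c args => fun w => interp c (fun i => truth V (args i) w)
  | Box psi => inf_acc (truth V psi)
  | Dia psi => sup_acc (truth V psi)
  end.

(* <phi_1, ..., phi_k; S> with k = sent_len.+1, so k >= 1: no rule can lead from
   a nonempty list of formulas to the empty one. *)
Record sentence := Sentence {
  sent_len : nat;
  sent_fml : 'I_sent_len.+1 -> fml;
  sent_set : set ('I_sent_len.+1 -> W -> I)
}.

Definition satisfies (V : model) (d : sentence) : Prop :=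
  sent_set (fun i => truth V (@sent_fml d i)).

Definition entails (Gamma : set sentence) (g : sentence) : Prop :=
  forall V : model, (forall d, Gamma d -> satisfies V d) -> satisfies V g.

Definition good (k : nat) (phi : 'I_k.+1 -> fml) (f : 'I_k.+1 -> W -> I) : Prop :=
  [/\ forall m (c : connective L) (s : 'I_(arity c) -> 'I_k.+1),
        phi m = Conn c (fun l => phi (s l)) ->
        f m = (fun w => interp c (fun l => f (s l) w)),
      forall i j, phi i = Box (phi j) -> f i = inf_acc (f j)
    & forall i j, phi i = Dia (phi j) -> f i = sup_acc (f j)].

(* The first k.+1 components of a tuple with m.+1 components. *)
Definition prefix_of (T : Type) (k m : nat) (km : (k < m)%N)
  (x : 'I_m.+1 -> T) : 'I_k.+1 -> T := fun i => x (widen_ord (leqW km) i).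

(* [step Gamma prev d]: d may extend a derivation whose earlier elements form
   the set prev. *)
Inductive step (Gamma prev : set sentence) : sentence -> Prop :=
| step_premise d : Gamma d -> step Gamma prev d
| step_axiom k (phi : 'I_k.+1 -> fml) : step Gamma prev (Sentence phi setT)
| step_perm k (phi : 'I_k.+1 -> fml) S (pi : 'S_k.+1) :
    prev (Sentence phi S) ->
    step Gamma prev (Sentence (phi \o pi) [set f \o pi | f in S])
| step_extend k m (km : (k < m)%N) (phi : 'I_m.+1 -> fml) S :
    prev (Sentence (prefix_of km phi) S) ->
    step Gamma prev (Sentence phi [set f | S (prefix_of km f)])
| step_cap k (phi : 'I_k.+1 -> fml) S1 S2 :
    prev (Sentence phi S1) -> prev (Sentence phi S2) ->
    step Gamma prev (Sentence phi (S1 `&` S2))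
| step_project k m (km : (k < m)%N) (phi : 'I_m.+1 -> fml) S :
    prev (Sentence phi S) ->
    step Gamma prev (Sentence (prefix_of km phi) [set prefix_of km f | f in S])
| step_weaken k (phi : 'I_k.+1 -> fml) S S' :
    S `<=` S' -> prev (Sentence phi S) -> step Gamma prev (Sentence phi S')
| step_good k (phi : 'I_k.+1 -> fml) S :
    prev (Sentence phi S) ->
    step Gamma prev (Sentence phi [set f | S f /\ good phi f]).

Definition proves (Gamma : set sentence) (g : sentence) : Prop :=
  exists (n : nat) (d : 'I_n.+1 -> sentence),
    d ord_max = g /\
    forall i : 'I_n.+1,
      step Gamma [set d j | j in [set j : 'I_n.+1 | (j < i)%N]] (d i).

(* No propositional variable is listed twice; this holds in particular when
   phi_1, ..., phi_k are pairwise distinct. *)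
Definition no_repeated_var (d : sentence) : Prop :=
  forall i j p, @sent_fml d i = Var p -> @sent_fml d j = Var p -> i = j.

End MDSentences.

Arguments satisfies {R L tau F} V d.
Arguments entails {R L tau F} Gamma g.
Arguments proves {R L tau F} Gamma g.
Arguments no_repeated_var {R L tau F} d.

(* Clauses (a)-(c) of [good] leave two components listing the same variable
   independent of each other, so without restriction the calculus is incomplete:
   with no connectives and acc = set0, the valid sentence
   <p, p; {(f, f) | f}> is not derivable. If finitely many connectives separate
   truth values in the sense below (as min, max, 1 - x or the Lukasiewicz, Goedel
   and product implications do), clause (a) forces such components to agree once
   the formulas Conn c (fun=> Var p) are listed. *)
Definition distinguishes (R : realType) (L : logic R) (c : connective L)
    (x y : {i01 R}) : Prop :=
  exists a b : 'I_(arity c) -> {i01 R},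
    [/\ range a `<=` [set x; y], range b `<=` [set x; y]
      & interp c a <> interp c b].

Definition separating (R : realType) (L : logic R) : Prop :=
  exists2 C : set (connective L), finite_set C &
    forall x y : {i01 R}, x <> y -> exists2 c, C c & distinguishes c x y.

(* Main.v *)
From Stdlib Require List.
Require Import Defs.
From mathcomp Require Import all_boot all_algebra all_fingroup.
From mathcomp Require Import all_classical all_reals interval_inference.

(** Soundness holds because each rule preserves satisfaction in a fixed model V:
    the tuple of maps that V assigns to the listed formulas is good, and every
    rule that transforms tuples sends the tuple of V to the tuple of V.

    For completeness, fix one finite list Phi of formulas that contains, up to
    repetition, every formula listed in Gamma or gamma and is closed under
    subformulas.  Each premise <phi; S> is a condition on the components of Phi
    at which phi sits, so extension and permutation turn it into a sentence about
    Phi ([proves_pullback]); intersecting these and keeping the good tuples gives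
    <Phi; T> with T the good tuples that meet all premises.  A good tuple over a
    subformula-closed list is the tuple of truth values of a model: the
    components at variables define the valuation, and goodness propagates it to
    compound formulas by induction ([good_is_truth]).  Hence the tuples in T come
    from models of Gamma, each of them meets gamma when Gamma entails gamma, and
    permuting, projecting and weakening <Phi; T> yields gamma
    ([complete_via_listing]).

    The delicate point is repetition.  If a premise lists a formula twice, then
    Phi has to list it twice as well, and the valuation is read off
    unambiguously only if components listing the same variable agree
    ([determines_vars]).  There are two ways to ensure this.  If no sentence
    repeats a variable, Phi need not either, while compound formulas are listed
    as often as necessary: their components are tied together by goodness.  If
    finitely many connectives separate truth values, Phi also lists c(p, ..., p)
    for each such connective c and each variable p.  Goodness determines this
    component from any choice, argument by argument, among the components listing
    p; if two of these took different values x and y at some world, a connective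
    distinguishing x from y would give that component two values
    ([determines_vars_separating]).  A list with prescribed multiplicities is an
    enumeration of a finite set of formulas paired with numbers
    ([finite_labelling]). *)

Set Implicit Arguments.
Unset Strict Implicit.
Unset Printing Implicit Defensive.

Local Open Scope classical_set_scope.

(** * Finite sets and permutations *)

Lemma finite_listing (T : Type) (A : set T) : finite_set A -> A !=set0 ->
  exists (n : nat) (e : 'I_n.+1 -> T), injective e /\ range e = A.
Proof.
move=> /(proj1 (@finite_seqP {classic T} A))[s As] [x0 Ax0].
have memA (x : {classic T}) : A x <-> x \in undup s by rewrite mem_undup As.
have : (0 < size (undup s))%N by case: (undup s) (memA x0) => // -[/(_ Ax0)].
case: (undup s) (undup_uniq s) memA => // x r Ur memA _.
exists (size r), (fun i => nth (x : {classic T}) (x :: r) i); split.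
  move=> i j /(@eqP {classic T}); rewrite nth_uniq// => /eqP ij.
  exact/val_inj.
apply/seteqP; split=> [_ [i _ <-]|y /memA yr]; first by apply/memA/mem_nth.
have ir : (index (y : {classic T}) (x :: r) < (size r).+1)%N.
  by rewrite index_mem.
by exists (Ordinal ir) => //; apply: (@nth_index {classic T}).
Qed.

Lemma finite_set_bounded (T : Type) (A : set T) (f : T -> nat) :
  finite_set A -> exists N, forall x, A x -> (f x <= N)%N.
Proof.
move=> /(@finite_image _ _ _ f)/finite_seqP[s fAs]; exists (\max_(n <- s) n).
move=> x Ax; have fxs : [set` s] (f x) by rewrite -fAs; exists x.
exact: (leq_bigmax_seq (f x) fxs isT).
Qed.

(** Lists the values of s, then the other elements of 'I_n in any order: this is a
    rearrangement of 'I_n. *)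
Lemma injection_extends_to_perm (k n : nat) (kn : (k <= n)%N)
    (s : 'I_k -> 'I_n) : injective s ->
  exists p : 'S_n, forall i, p (widen_ord kn i) = s i.
Proof.
move=> s_inj.
pose t := map s (enum 'I_k).
have ut : uniq t by rewrite map_inj_uniq ?enum_uniq.
have : perm_eq (t ++ [seq j <- enum 'I_n | j \notin t]) (ord_tuple n).
  apply: uniq_perm.
  - rewrite cat_uniq ut filter_uniq ?enum_uniq// andbT.
    by apply/hasPn => j; rewrite mem_filter => /andP[].
  - by rewrite val_ord_tuple enum_uniq.
  - by move=> j; rewrite val_ord_tuple mem_cat mem_filter mem_enum andbT orbN.
move=> /tuple_permP[p tp]; exists p => i.
have ti : nth (s i) t i = s i.
  by rewrite (nth_map i) ?size_enum_ord// nth_ord_enum.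
rewrite -[RHS]ti.
have -> : nth (s i) t i = nth (s i) (t ++ [seq j <- enum 'I_n | j \notin t]) i.
  by rewrite nth_cat size_map size_enum_ord ltn_ord.
rewrite tp -[i : nat]/(val (widen_ord kn i)) -tnth_nth.
by rewrite tnth_mktuple tnth_ord_tuple.
Qed.

(** * Soundness *)

Section Calculus.
Variables (R : realType) (L : logic R) (tau : Type) (F : frame).
Local Notation I := {i01 R}.
Local Notation W := (world F).
Local Notation fml := (formula L tau).
Local Notation sentence := (sentence L tau F).
Local Notation fmls d := (@sent_fml R L tau F d).
Implicit Types (Gamma prev : set sentence) (V : model R tau F).

Lemma good_truth V (k : nat) (phi : 'I_k.+1 -> fml) :
  good phi (fun i => truth V (phi i)).
Proof. by split=> [m c s ->|i j ->|i j ->]. Qed.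

Lemma step_sound Gamma prev V d : (forall e, Gamma e -> satisfies V e) ->
  (forall e, prev e -> satisfies V e) -> step Gamma prev d -> satisfies V d.
Proof.
move=> sG sP; case=> {d} [d /sG//|k phi//|k phi S pi /sP|k m km phi S /sP//|
  k phi S1 S2 /sP s1 /sP s2|k m km phi S /sP|k phi S S' SS' /sP/SS'//|
  k phi S /sP].
- by move=> Sf; exists (fun i => truth V (phi i)).
- by split.
- by move=> Sf; exists (fun i => truth V (phi i)).
- by move=> Sf; split=> //; apply: good_truth.
Qed.

Lemma proves_sound Gamma gamma : proves Gamma gamma -> entails Gamma gamma.
Proof.
move=> [n [d [<- dP]]] V sG.
suff sd m (i : 'I_n.+1) : i = m :> nat -> satisfies V (d i) by apply: sd erefl.
elim/ltn_ind: m i => m IHm i im; apply: step_sound (dP i) => // _ [j /= ji <-].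
by apply: IHm erefl; rewrite -im.
Qed.

(** * Closure of provability under the rules *)

Lemma step_mono Gamma prev prev' d :
  prev `<=` prev' -> step Gamma prev d -> step Gamma prev' d.
Proof.
move=> pp; case=> {d}; [exact: step_premise|exact: step_axiom|..].
- by move=> k phi S pi /pp; apply: step_perm.
- by move=> k m km phi S /pp; apply: step_extend.
- by move=> k phi S1 S2 /pp s1 /pp; apply: step_cap.
- by move=> k m km phi S /pp; apply: step_project.
- by move=> k phi S S' SS' /pp; apply: step_weaken.
- by move=> k phi S /pp; apply: step_good.
Qed.

(** Derivations as sequences, for which concatenation is available; the default
    value of [nth], never reached, is quantified so that none has to be chosen. *)
Definition derivation Gamma (s : seq sentence) : Prop :=
  forall x0 i, (i < size s)%N ->
    step Gamma [set nth x0 s j | j in [set j | (j < i)%N]] (nth x0 s i).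

Lemma provesP Gamma d :
  proves Gamma d <-> exists s, derivation Gamma (rcons s d).
Proof.
split=> [[n [e [<- eP]]]|[s sP]].
  exists [seq e (widen_ord (leqnSn n) i) | i <- enum 'I_n].
  set s := [seq _ | _ <- _].
  have es x0 (i : 'I_n.+1) : nth x0 (rcons s (e ord_max)) i = e i.
    rewrite nth_rcons size_map size_enum_ord; case: ltnP => [lin|].
      rewrite (nth_map (Ordinal lin)) ?size_enum_ord//.
      by congr e; apply/val_inj; rewrite /= nth_enum_ord.
    move=> ni; have ein : i = n :> nat.
      by apply/eqP; rewrite eqn_leq ni -ltnS ltn_ord.
    by rewrite ein eqxx; congr e; apply/val_inj.
  move=> x0 i; rewrite size_rcons size_map size_enum_ord => lin.
  have := eP (Ordinal lin); rewrite -(es x0 (Ordinal lin)) /=; apply: step_mono.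
  by move=> _ [j /= ji <-]; exists j; rewrite ?es.
exists (size s), (fun i => nth d (rcons s d) i); split.
  by rewrite nth_rcons ltnn eqxx.
move=> i; have := sP d i; rewrite size_rcons => /(_ (ltn_ord i)).
apply: step_mono => _ [j /= ji <-].
by exists (Ordinal (ltn_trans ji (ltn_ord i))).
Qed.

Lemma derivation_cat Gamma s t :
  derivation Gamma s -> derivation Gamma t -> derivation Gamma (s ++ t).
Proof.
move=> sP tP x0 i; rewrite size_cat => ist.
have [lis|lsi] := ltnP i (size s).
  rewrite nth_cat lis; apply: step_mono (sP x0 i lis) => _ [j /= ji <-].
  by exists j; rewrite // nth_cat (ltn_trans ji lis).
rewrite nth_cat ltnNge lsi /=.
have lit : (i - size s < size t)%N by rewrite ltn_subLR.
apply: step_mono (tP x0 _ lit) => _ [j /= ji <-].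
exists (size s + j)%N; first by rewrite /= -ltn_subRL.
by rewrite nth_cat ltnNge leq_addr addKn.
Qed.

Lemma derivation_rcons Gamma s prev d : derivation Gamma s ->
  prev `<=` [set e | List.In e s] -> step Gamma prev d ->
  derivation Gamma (rcons s d).
Proof.
move=> sP ps std x0 i; rewrite size_rcons ltnS leq_eqVlt => /orP[/eqP->|lis].
  rewrite nth_rcons ltnn eqxx; apply: step_mono std => e /ps /= es.
  have [j js <-] : exists2 j, (j < size s)%N & nth x0 s j = e.
    elim: s es {sP ps} => //= x s IHs [<-|/IHs[j js <-]]; first by exists 0%N.
    by exists j.+1.
  by exists j; rewrite // nth_rcons js.
rewrite nth_rcons lis; apply: step_mono (sP x0 i lis) => _ [j /= ji <-].
by exists j; rewrite // nth_rcons (ltn_trans ji lis).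
Qed.

(** No rule has more than two premises, so this covers all of them; concatenating
    the two derivations supplies both premises at once. *)
Lemma proves_step Gamma d1 d2 d : proves Gamma d1 -> proves Gamma d2 ->
  step Gamma [set d1; d2] d -> proves Gamma d.
Proof.
move=> /provesP[s1 s1P] /provesP[s2 s2P] std; apply/provesP.
exists (rcons s1 d1 ++ rcons s2 d2).
apply: derivation_rcons (derivation_cat s1P s2P) _ std => e /=.
rewrite -!cats1 !List.in_app_iff /=.
by case=> ->; [left; right; left|right; right; left].
Qed.

Lemma proves_step0 Gamma d : step Gamma set0 d -> proves Gamma d.
Proof.
move=> std; apply/provesP; exists [::].
by apply: (derivation_rcons _ _ std).
Qed.

Lemma proves_step1 Gamma d1 d : proves Gamma d1 ->
  step Gamma [set d1] d -> proves Gamma d.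
Proof.
move=> p1 std; apply: (proves_step p1 p1).
by apply: step_mono std => e ->; left.
Qed.

(** The empty intersection is an axiom, and a finite one is reached by
    intersecting one sentence at a time. *)
Lemma proves_bigcap Gamma (T : Type) (D : set T) (k : nat)
    (phi : 'I_k.+1 -> fml) (S : T -> set ('I_k.+1 -> W -> I)) :
  finite_set D -> (forall x, D x -> proves Gamma (Sentence phi (S x))) ->
  proves Gamma (Sentence phi (\bigcap_(x in D) S x)).
Proof.
move=> /(proj1 (@finite_seqP {classic T} D))[s ->] {D}.
elim: s => [_|x s IHs pS].
  rewrite classical_sets.set_nil bigcap_set0.
  by apply: proves_step0; apply: step_axiom.
have xs : [set` x :: s] = x |` [set` s].
  by apply/seteqP; split=> y /=; rewrite inE => /predU1P.
rewrite xs bigcap_setU bigcap_set1.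
apply: (@proves_step _ (Sentence phi (S x))
  (Sentence phi (\bigcap_(y in [set` s]) S y))).
- by apply: pS; rewrite xs; left.
- by apply: IHs => y sy; apply: pS; rewrite xs; right.
- by apply: step_cap; [left|right].
Qed.

Lemma proves_perm Gamma (n : nat) (phi : 'I_n.+1 -> fml) S (p : 'S_n.+1) :
  proves Gamma (Sentence phi S) ->
  proves Gamma (Sentence (phi \o p)
    [set f : 'I_n.+1 -> W -> I | S (f \o (p^-1)%g)]).
Proof.
move=> /proves_step1; apply.
have -> : [set f : 'I_n.+1 -> W -> I | S (f \o (p^-1)%g)] =
    [set f \o p | f in S].
  apply/seteqP; split=> [f Sf|_ [f Sf <-] /=].
    by exists (f \o (p^-1)%g) => //; apply/funext => i /=; rewrite permK.
  by rewrite (_ : _ \o _ = f)//; apply/funext => i /=; rewrite permKV.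
exact: step_perm.
Qed.

(** Extension appends components at the end of a list; a permutation extending s
    moves them to where Phi has them. *)
Lemma proves_pullback Gamma (k n : nat) (s : 'I_k.+1 -> 'I_n.+1)
    (Phi : 'I_n.+1 -> fml) S : injective s ->
  proves Gamma (Sentence (Phi \o s) S) ->
  proves Gamma (Sentence Phi [set f : 'I_n.+1 -> W -> I | S (f \o s)]).
Proof.
move=> s_inj.
have kn : (k <= n)%N by have := leq_card s s_inj; rewrite !card_ord.
have [p ps] := @injection_extends_to_perm k.+1 n.+1 kn s s_inj.
have [kn'|] := ltnP k n; last first.
  (* Extension lengthens a list strictly; for k = n the injection is itself a
     permutation. *)
  move=> nk; have ekn : k = n by apply/eqP; rewrite eqn_leq kn.
  subst n; have -> : s = p.
    by apply/funext => i; rewrite -ps; congr (p _); apply/val_inj.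
  move=> /(proves_perm (p^-1)%g); rewrite -compA invgK.
  by rewrite (_ : p \o _ = id)//; apply/funext => i /=; rewrite permKV.
have psE : s = p \o widen_ord (leqW kn').
  by apply/funext => i; rewrite -ps /=; congr (p _); apply/val_inj.
move=> pS.
have /(proves_perm (p^-1)%g) : proves Gamma
    (Sentence (Phi \o p) [set f | S (prefix_of kn' f)]).
  apply: (proves_step1 pS); apply: step_extend.
  by rewrite psE.
rewrite invgK (_ : (Phi \o p) \o _ = Phi); last first.
  by apply/funext => i /=; rewrite permKV.
by rewrite psE.
Qed.

(** The dual of [proves_pullback]: a permutation extending s brings the wanted
    components to the front, and projection drops the others. *)
Lemma proves_image Gamma (k n : nat) (s : 'I_k.+1 -> 'I_n.+1)
    (Phi : 'I_n.+1 -> fml) S : injective s ->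
  proves Gamma (Sentence Phi S) ->
  proves Gamma (Sentence (Phi \o s) [set f \o s | f in S]).
Proof.
move=> s_inj.
have kn : (k <= n)%N by have := leq_card s s_inj; rewrite !card_ord.
have [p ps] := @injection_extends_to_perm k.+1 n.+1 kn s s_inj.
have [kn'|] := ltnP k n; last first.
  (* Projection shortens a list strictly; for k = n the injection is itself a
     permutation. *)
  move=> nk; have ekn : k = n by apply/eqP; rewrite eqn_leq kn.
  subst n; have -> : s = p.
    by apply/funext => i; rewrite -ps; congr (p _); apply/val_inj.
  by move=> /proves_step1; apply; apply: step_perm.
have psE : s = p \o widen_ord (leqW kn').
  by apply/funext => i; rewrite -ps /=; congr (p _); apply/val_inj.
move=> /(proves_perm p) /proves_step1; apply.
have -> : [set f \o s | f in S] =
    [set prefix_of kn' f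
       | f in [set f : 'I_n.+1 -> W -> I | S (f \o (p^-1)%g)]].
  apply/seteqP; split=> [_ [f Sf <-]|_ [f /= Sf <-]].
    exists (f \o p); last by rewrite psE.
    rewrite /= -compA (_ : p \o _ = id)//.
    by apply/funext => i /=; rewrite permKV.
  exists (f \o (p^-1)%g) => //; rewrite psE; apply/funext => i.
  by rewrite /prefix_of /= permK.
rewrite psE.
exact: (@step_project _ _ _ _ _ _ _ _ kn' (Phi \o p)).
Qed.

(** * Good tuples and models *)

Fixpoint subformulas (phi : fml) : set fml :=
  phi |` match phi with
         | Var _ => set0
         | Conn _ args => \bigcup_i subformulas (args i)
         | Box psi | Dia psi => subformulas psi
         end.

Lemma subformulas_refl phi : subformulas phi phi.
Proof. by case: phi; left. Qed.

Lemma subformulas_trans phi psi :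
  subformulas phi psi -> subformulas psi `<=` subformulas phi.
Proof.
elim: phi => [v|c args IH|phi IH|phi IH] /= [->//|//].
- by move=> [i _ /IH ipsi] x /ipsi; right; exists i.
- by move=> /IH ipsi x /ipsi; right.
- by move=> /IH ipsi x /ipsi; right.
Qed.

Lemma finite_subformulas phi : finite_set (subformulas phi).
Proof.
elim: phi => [v|c args IH|phi IH|phi IH] /=; rewrite finite_setU; split=> //.
exact: bigcup_finite.
Qed.

Definition subformula_closed (C : set fml) : Prop :=
  forall phi, C phi -> subformulas phi `<=` C.

(** Clauses (a)-(c) of goodness do not directly relate two components that list
    the same variable. *)
Definition determines_vars (k : nat) (phi : 'I_k.+1 -> fml) : Prop :=
  forall f : 'I_k.+1 -> W -> I, good phi f ->
    forall i j p, phi i = Var p -> phi j = Var p -> f i = f j.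

(** The valuation takes for p the component at any place where Phi lists it.  The
    clauses of goodness then compute every other component from components of
    immediate subformulas, which closure makes available. *)
Lemma good_is_truth (n : nat) (Phi : 'I_n.+1 -> fml) f :
  subformula_closed (range Phi) -> determines_vars Phi -> good Phi f ->
  exists V : model R tau F, f = fun i => truth V (Phi i).
Proof.
move=> closedP detP gf; have [fC fB fD] := gf.
have /choice[V VP] p : exists v : W -> I, forall i, Phi i = Var p -> f i = v.
  have [[j Pj]|nex] := pselect (exists j, Phi j = Var p).
    by exists (f j) => i Pi; apply: (detP f gf _ _ p).
  (* Phi does not list p, so any value will do. *)
  by exists (f ord0) => i Pi; case: nex; exists i.
have sub i psi : subformulas (Phi i) psi -> exists j, Phi j = psi.
  move=> Pi_psi.
  by have [|j _ <-] := closedP (Phi i) _ psi Pi_psi; [exists i|exists j].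
exists V; apply/funext => i.
suff fV phi : forall i, Phi i = phi -> f i = truth V phi by apply: fV.
elim: phi => {i} [p|c args IH|phi IH|phi IH] i Pi; first exact: VP.
- have /choice[s sP] l : exists j, Phi j = args l.
    apply: (sub i); rewrite Pi.
    by right; exists l => //; apply: subformulas_refl.
  rewrite (fC i c s) => [|]; first apply/funext => w /=.
    by congr interp; apply/funext => l; rewrite (IH l).
  by rewrite Pi; congr Conn; apply/funext => l; rewrite sP.
- have [|j Pj] := sub i phi.
    by rewrite Pi; right; apply: subformulas_refl.
  by rewrite (fB i j) ?Pi ?Pj// (IH j Pj).
- have [|j Pj] := sub i phi.
    by rewrite Pi; right; apply: subformulas_refl.
  by rewrite (fD i j) ?Pi ?Pj// (IH j Pj).
Qed.

(** * Completeness from a suitable list *)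

(** The premises, pulled back to Phi and intersected, hold of a good tuple only if
    the model which that tuple comes from satisfies Gamma, hence gamma.  Each
    sentence sits in Phi along an injection because permutation, extension and
    projection can neither merge nor duplicate components. *)
Lemma complete_via_listing Gamma (gamma : sentence) (n : nat)
    (Phi : 'I_n.+1 -> fml) : finite_set Gamma ->
  subformula_closed (range Phi) -> determines_vars Phi ->
  (forall d, (gamma |` Gamma) d ->
    exists2 s : 'I_(sent_len d).+1 -> 'I_n.+1, injective s
    & Phi \o s = fmls d) ->
  entails Gamma gamma -> proves Gamma gamma.
Proof.
move=> finG closedP detP embP Gg.
have /choice[S SP] d : exists S : set (_ -> W -> I), Gamma d ->
    proves Gamma (Sentence Phi S) /\
    forall V, S (fun i => truth V (Phi i)) -> satisfies V d.
  have [Gd|nGd] := pselect (Gamma d); last by exists set0 => /nGd.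
  have [|s s_inj Ps] := embP d; first by right.
  exists [set f : 'I_n.+1 -> W -> I | sent_set (s := d) (f \o s)] => _; split.
    apply: proves_pullback => //; apply: proves_step0; rewrite Ps.
    by apply: step_premise; case: (d) Gd.
  by move=> V; rewrite /satisfies -Ps.
have [|s s_inj Ps] := embP gamma; first by left.
have pC : proves Gamma (Sentence Phi (\bigcap_(d in Gamma) S d)).
  by apply: proves_bigcap => // d /SP[].
have /(proves_image s_inj) : proves Gamma (Sentence Phi
    [set f | (\bigcap_(d in Gamma) S d) f /\ good Phi f]).
  by apply: (proves_step1 pC); apply: step_good.
rewrite Ps; case: gamma Gg s s_inj Ps {embP} => k phi S0 Gg s _ Ps.
move=> /proves_step1; apply; apply: step_weaken; last by [].
move=> _ [f [fS gf] <-]; have [V fV] := good_is_truth closedP detP gf; subst f.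
have := Gg V; rewrite /satisfies /= -[phi]Ps; apply => d Gd.
exact: (SP d Gd).2 _ (fS d Gd).
Qed.

(** The list enumerates the pairs of a formula in C and a number at most b of it,
    so that each formula occurs with multiplicity one more than its bound.
    A tuple embeds in the list by numbering its components by their positions,
    truncated at the bound, as long as this tells equal formulas apart. *)
Lemma finite_labelling (C : set fml) (b : fml -> nat) :
  finite_set C -> C !=set0 ->
  exists (n : nat) (Phi : 'I_n.+1 -> fml),
  [/\ range Phi = C,
      (forall i j, Phi i = Phi j -> b (Phi i) = 0%N -> i = j)
    & forall k (phi : 'I_k.+1 -> fml), range phi `<=` C ->
      (forall i j, phi i = phi j ->
         minn i (b (phi i)) = minn j (b (phi j)) -> i = j) ->
      exists2 s : 'I_k.+1 -> 'I_n.+1, injective s & Phi \o s = phi].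
Proof.
move=> finC [phi0 Cphi0].
pose K := [set x : fml * nat | C x.1 /\ (x.2 <= b x.1)%N].
have finK : finite_set K.
  have [N bN] := finite_set_bounded b finC.
  apply: (@sub_finite_set _ _ (C `*` `I_N.+1)); last exact: finite_setX.
  by move=> x [Cx xb]; split; rewrite //= ltnS (leq_trans xb)// bN.
have [|n [e [e_inj eK]]] := finite_listing finK; first by exists (phi0, 0%N).
have Ke i : K (e i) by rewrite -eK.
exists n, (fun i => (e i).1); split.
- apply/seteqP; split=> [_ [i _ <-]|phi Cphi]; first by case: (Ke i).
  have [i _ ei] : range e (phi, 0%N) by rewrite eK.
  by exists i; rewrite // ei.
- move=> i j /= eij bi; apply: e_inj.
  have := (Ke i).2; have := (Ke j).2; rewrite -eij bi !leqn0 => /eqP j0 /eqP i0.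
  by rewrite (surjective_pairing (e i)) (surjective_pairing (e j)) eij i0 j0.
- move=> k phi Cphi inj_phi.
  have /choice[s sP] i : exists j, e j = (phi i, minn i (b (phi i))).
    have [j _ ej] : range e (phi i, minn i (b (phi i))); last by exists j.
    by rewrite eK; split; rewrite /= ?geq_minr//; apply: Cphi; exists i.
  exists s; last by apply/funext => i /=; rewrite sP.
  move=> i j sij; have := sP i.
  by rewrite sij sP => -[/esym ? /esym]; apply: inj_phi.
Qed.

(** * Agreement of the components of a variable *)

Lemma determines_vars_unique (n : nat) (Phi : 'I_n.+1 -> fml) :
  (forall i j p, Phi i = Var p -> Phi j = Var p -> i = j) -> determines_vars Phi.
Proof. by move=> uP f _ i j p Pi Pj; rewrite (uP i j p). Qed.

(** If the components i and j of p differ at w, pick for each argument place of a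
    distinguishing connective c whichever of i and j has the prescribed value at
    w.  All these choices describe the same formula c(p, ..., p), so goodness
    gives its component both of the values that c tells apart. *)
Lemma determines_vars_separating (n : nat) (Phi : 'I_n.+1 -> fml)
    (C : set (connective L)) :
  (forall x y : I, x <> y -> exists2 c, C c & distinguishes c x y) ->
  (forall c p, C c -> range Phi (Var p) -> range Phi (Conn c (fun=> Var p))) ->
  determines_vars Phi.
Proof.
move=> sepC ConnP f [fC _ _] i j p Pi Pj; apply/funext => w.
apply: contrapT => /sepC[c Cc [a [b [aij bij]]]]; apply.
have [|m _ Pm] := ConnP c p Cc; first by exists i.
have fm a' : range a' `<=` [set f i w; f j w] -> f m w = interp c a'.
  move=> a'P; have /choice[s sP] l : exists k, Phi k = Var p /\ f k w = a' l.
    by have [|->|->] := a'P (a' l); [exists l|exists i|exists j].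
  rewrite (fC m c s); first by congr interp; apply/funext => l; case: (sP l).
  by rewrite Pm; congr Conn; apply/funext => l; case: (sP l).
by rewrite -(fm a)// -(fm b).
Qed.

(** * Construction of the list *)

(** Adding c(phi, ..., phi) for phi in a closed set keeps it closed, since its
    subformulas are itself and those of phi.  The added formulas introduce no
    variables, so one round is enough. *)
Lemma closure_exists (Delta : set sentence) (C : set (connective L)) :
  finite_set Delta -> finite_set C ->
  exists D : set fml, [/\ finite_set D, subformula_closed D,
    forall d (i : 'I_(sent_len d).+1), Delta d -> D (sent_fml i)
  & forall c p, C c -> D (Var p) -> D (Conn c (fun=> Var p))].
Proof.
move=> finDelta finC.
pose D0 := \bigcup_(d in Delta) \bigcup_i subformulas (fmls d i).
have D0_closed : subformula_closed D0.
  move=> phi [d Dd [i _ /subformulas_trans phi_d]] psi /phi_d psi_d.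
  by exists d => //; exists i.
exists (D0 `|` [set Conn c (fun=> phi) | c in C & phi in D0]); split.
- have finD0 : finite_set D0.
    apply: bigcup_finite => // d _; apply: bigcup_finite => // i _.
    exact: finite_subformulas.
  by rewrite finite_setU; split=> //; apply: finite_image2.
- move=> phi [/D0_closed D0phi psi /D0phi|]; first by left.
  move=> [c Cc [psi D0psi <-]] chi /= [->|[_ _ /(D0_closed _ D0psi)]].
    by right; exists c => //; exists psi.
  by left.
- move=> d i Dd; left; exists d => //; exists i => //.
  exact: subformulas_refl.
- move=> c p Cc [Dp|[? _ [? _]]//].
  by right; exists c => //; exists (Var p).
Qed.

(** Isolates what depends on the treatment of repeated variables: the bounds b on
    the multiplicities have to leave room for all the sentences, yet force
    agreement of the components of each variable. *)
Lemma complete_of_labels Gamma (gamma : sentence) (b : fml -> nat)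
    (C : set (connective L)) :
  finite_set Gamma -> finite_set C ->
  (forall d (i j : 'I_(sent_len d).+1), (gamma |` Gamma) d ->
    sent_fml i = sent_fml j ->
    minn i (b (sent_fml i)) = minn j (b (sent_fml j)) ->
    i = j) ->
  (forall n (Phi : 'I_n.+1 -> fml),
    (forall i j, Phi i = Phi j -> b (Phi i) = 0%N -> i = j) ->
    (forall c p, C c -> range Phi (Var p) ->
      range Phi (Conn c (fun=> Var p))) -> determines_vars Phi) ->
  entails Gamma gamma -> proves Gamma gamma.
Proof.
move=> finG finC b_inj detP Gg.
have finD : finite_set (gamma |` Gamma) by rewrite finite_setU.
have [D [fin_D closedD sentD ConnD]] := closure_exists finD finC.
have D_neq0 : D !=set0 by exists (fmls gamma ord0); apply: sentD; left.
have [n [Phi [rPhi uPhi embPhi]]] := finite_labelling b fin_D D_neq0.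
apply: (@complete_via_listing _ _ _ Phi) => //; rewrite ?rPhi//.
  by apply: detP => // c p; rewrite rPhi; apply: ConnD.
move=> d Dd; apply: embPhi; last by move=> i j; apply: b_inj.
by move=> _ [i _ <-]; apply: sentD.
Qed.

End Calculus.

Theorem theorem12 (R : realType) (L : logic R) (tau : Type) (F : frame)
    (Gamma : set (sentence L tau F)) (gamma : sentence L tau F)
    (Gamma_finite : finite_set Gamma) :
  (proves Gamma gamma -> entails Gamma gamma) /\
  (separating L \/
     (forall d, Gamma d \/ d = gamma -> no_repeated_var d) ->
   entails Gamma gamma -> proves Gamma gamma).
Proof.
split; first exact: proves_sound.
have finD : finite_set (gamma |` Gamma) by rewrite finite_setU.
have [N lenN] := finite_set_bounded (@sent_len _ _ _ _) finD.
have posN d (i : 'I_(sent_len d).+1) : (gamma |` Gamma) d -> minn i N = i.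
  by move=> Dd; apply/minn_idPl/(leq_trans _ (lenN d Dd)); rewrite -ltnS.
case=> [[C finC sepC]|no_rep].
  (* Every formula gets enough copies for each position in any sentence. *)
  apply: (@complete_of_labels _ _ _ _ _ _ (fun=> N) C) => //.
    by move=> d i j Dd _; rewrite !posN// => /val_inj.
  move=> n Phi _ ConnPhi.
  exact: (@determines_vars_separating _ _ _ _ _ _ C).
(* Variables are listed once, compound formulas as often as positions need. *)
pose b (phi : formula L tau) := if phi is Var _ then 0%N else N.
apply: (@complete_of_labels _ _ _ _ _ _ b set0) => //.
  move=> d i j Dd ij; rewrite -ij.
  case phi_i: (sent_fml i) => [p|c args|phi|phi] /=.
  - by have /no_rep/(_ i j p phi_i) : Gamma d \/ d = gamma;
      [case: Dd; [right|left]|rewrite -ij => /(_ phi_i)].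
  - by rewrite !posN// => /val_inj.
  - by rewrite !posN// => /val_inj.
  - by rewrite !posN// => /val_inj.
move=> n Phi uPhi _; apply: determines_vars_unique => i j p Pi Pj.
by apply: uPhi; rewrite Pi.
Qed.
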